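(* Let $r \geq 1$ and $d \geq 1$ be integers, and let $G$ be a graph on $n$ vertices satisfying the $(r+d+1)$-strong neighbourhood property. Let $\Delta$ denote the maximum degree of a vertex in $G$, and assume $\Delta \geq 2$. Let $\theta_n = \theta_n(G,r,d)$ be the minimum size of an identification code of $G$ with index $r$. Then \[ \frac{1}{\Delta+1} \leq \frac{\theta_n}{n} \leq 1-\frac{c(d,r)}{(\Delta+1)^{(r+2)/d}}, \qquad\text{where } c(d,r) := d\,(d+1)^{-1-1/d}\,(2r)^{-1/d}. \]
   Context: All graphs are finite and simple, with vertex set $V=\{1,\dots,n\}$. For a vertex $v$, $N(v)$ is the set of vertices adjacent to $v$ (not including $v$), and $N[v] = N(v)\cup\{v\}$. For a set $A$, $\#A$ denotes its cardinality. A set of vertices $\mathcal{C}$ is an identification code for $G$ with index $r$ if for any two distinct vertices $u,v$ of $G$, $\#\big((N[v]\setminus N[u])\cap \mathcal{C}\big) \geq r$. For an integer $k\ge 1$, $G$ has the $k$-strong neighbourhood property if for any two distinct vertices $u,v$ of $G$, $\#\big(N[v]\setminus N[u]\big) \geq k$. *)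

(* Defs.v *)
From mathcomp Require Import all_boot all_order all_algebra.
From mathcomp Require Import reals exp.

Set Implicit Arguments.
Unset Strict Implicit.
Unset Printing Implicit Defensive.

Record sgraph (n : nat) := SGraph {
  adj :> rel 'I_n;
  adj_sym : symmetric adj;
  adj_irrefl : irreflexive adj
}.

Section Graph.
Variables (n : nat) (G : sgraph n).

Definition nbh (v : 'I_n) : {set 'I_n} := [set u | G v u].

Definition cnbh (v : 'I_n) : {set 'I_n} := v |: nbh v.

Definition maxdeg : nat := \max_(v < n) #|nbh v|.

Definition id_code (r : nat) (C : {set 'I_n}) : bool :=
  [forall u, forall v, (u != v) ==> (r <= #|(cnbh v :\: cnbh u) :&: C|)].

Definition strong_nbh (k : nat) : Prop :=
  forall u v : 'I_n, u != v -> k <= #|cnbh v :\: cnbh u|.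

(* The default [set: 'I_n] is itself a code of index r as soon as any code of
   index r exists, so this is the true minimum in that case. *)
Definition min_id_code (r : nat) : nat :=
  #|[arg min_(C < [set: 'I_n] | id_code r C) #|C|]|.

Lemma strong_nbh_id_codeT (r k : nat) :
  r <= k -> strong_nbh k -> id_code r [set: 'I_n].
Proof.
move=> rk sG; apply/forallP => u; apply/forallP => v; apply/implyP => uv.
by rewrite setIT (leq_trans rk) ?sG.
Qed.

Lemma min_id_codeP (r : nat) (C : {set 'I_n}) : id_code r C ->
  (exists2 D, id_code r D & #|D| = min_id_code r) /\
  (forall D, id_code r D -> min_id_code r <= #|D|).
Proof.
move=> cC; rewrite /min_id_code; case: arg_minnP => [|D cD minD].
  apply/forallP => u; apply/forallP => v; apply/implyP => uv.
  move/forallP/(_ u)/forallP/(_ v)/implyP/(_ uv): cC => /leq_trans; apply.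
  by rewrite setIT subset_leq_card ?subsetIl.
by split=> //; exists D.
Qed.

End Graph.

Local Open Scope ring_scope.

Definition cst_dr (R : realType) (d r : nat) : R :=
  d%:R * d.+1%:R `^ (- 1 - d%:R^-1) * (2 * r)%:R `^ (- d%:R^-1).

(* Main.v *)
(** Lower bound: a code meets every closed neighbourhood, and each of its
    vertices lies in at most [Delta + 1] of them.

    Upper bound, by alteration: leave each vertex out of the code independently
    with probability [p].  Only pairs [(u, v)] whose closed neighbourhoods meet
    matter, and there are at most [n (Delta + 1)^2] of them; such a pair is
    deficient when fewer than [r] vertices of [N[v] \ N[u]] are kept, which
    happens with probability at most [(Delta + 1)^(r-1) p^(d+2)].  Putting back
    [r] vertices for each deficient pair yields a code, so on average at least
    [n (p - A p^(d+1))] vertices stay out, with [A = 2 r (Delta + 1)^(r+2)].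
    The bound is the value at the maximiser [p = (A (d+1))^(-1/d)]. *)

Require Import Defs.
From mathcomp Require Import all_boot all_order all_algebra.
From mathcomp Require Import reals exp.
From mathcomp Require Import ring zify.

Set Implicit Arguments.
Unset Strict Implicit.
Unset Printing Implicit Defensive.

Import Order.TTheory GRing.Theory Num.Theory.

Lemma ffact_leq_exp (n m : nat) : n ^_ m <= n ^ m.
Proof.
rewrite ffact_prod -[m in leqRHS]card_ord -prod_nat_const.
by apply: leq_prod => i _; apply: leq_subr.
Qed.

Lemma bin_leq_exp (n m : nat) : 'C(n, m) <= n ^ m.
Proof.
by apply: leq_trans (ffact_leq_exp n m); rewrite -bin_ffact leq_pmulr ?fact_gt0.
Qed.

Lemma card_bigcup_leq_mul (I T : finType) (P : {pred I}) (F : I -> {set T})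
    (m : nat) :
  (forall i, i \in P -> #|F i| <= m) -> #|\bigcup_(i in P) F i| <= #|P| * m.
Proof.
move=> Fm; rewrite -sum_nat_const.
elim/big_rec2: _ => [|i k A /Fm Fim Ak]; first by rewrite cards0.
by rewrite (leq_trans (leq_card_setU _ _)) ?leq_add.
Qed.

Lemma exists_hitting_set (I T : finType) (P : {pred I}) (F : I -> {set T})
    (r : nat) :
  (forall i, i \in P -> r <= #|F i|) ->
  exists2 U : {set T}, #|U| <= #|P| * r
    & forall i, i \in P -> r <= #|F i :&: U|.
Proof.
move=> rF; pose S i := [set x in take r (enum (F i))].
have cardS i : #|S i| = minn r #|F i|.
  by rewrite cardsE (card_uniqP _) ?take_uniq ?enum_uniq // size_take_min cardE.
exists (\bigcup_(i in P) S i) => [|i Pi].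
  by apply: card_bigcup_leq_mul => i _; rewrite cardS geq_minl.
rewrite -[leqLHS](minn_idPl (rF i Pi)) -cardS.
rewrite subset_leq_card // subsetI bigcup_sup // andbT.
by apply/subsetP => x; rewrite inE => /mem_take; rewrite mem_enum.
Qed.

Local Open Scope ring_scope.

Lemma sum_indicator (R : pzSemiRingType) (T : finType) (A : {set T})
    (P : pred T) :
  \sum_(x in A) (P x)%:R = #|[set x in A | P x]|%:R :> R.
Proof.
rewrite -sum1_card natr_sum big_mkcond [RHS]big_mkcond /=.
by apply: eq_bigr => x _; rewrite inE; case: (x \in A); case: (P x).
Qed.

Section RandomSubset.
Variables (R : comNzRingType) (T : finType) (p : R).
Implicit Types (A X : {set T}) (f g : {set T} -> R).

Definition subset_weight X : R := \prod_i (if i \in X then p else 1 - p).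

Definition subset_mean f : R := \sum_X subset_weight X * f X.

Lemma subset_meanD f g :
  subset_mean (fun X => f X + g X) = subset_mean f + subset_mean g.
Proof. by rewrite -big_split; apply: eq_bigr => X _; rewrite mulrDr. Qed.

Lemma subset_meanZ (c : R) f :
  subset_mean (fun X => c * f X) = c * subset_mean f.
Proof. by rewrite mulr_sumr; apply: eq_bigr => X _; rewrite mulrCA. Qed.

Lemma subset_mean_sum (I : finType) (P : pred I) (f : I -> {set T} -> R) :
  subset_mean (fun X => \sum_(i | P i) f i X) =
  \sum_(i | P i) subset_mean (f i).
Proof. by rewrite exchange_big; apply: eq_bigr => X _; rewrite mulr_sumr. Qed.

Lemma subset_mean_supset A :
  subset_mean (fun X => (A \subset X)%:R) = p ^+ #|A|.
Proof.
transitivity (\prod_(i : T) (p + (if i \in A then 0 else 1 - p))).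
  rewrite bigA_distr; apply: eq_bigr => X _.
  have [AX|/subsetPn[x xA xX]] := boolP (A \subset X).
    rewrite mulr1; apply: eq_bigr => i _; case: ifPn => // iX.
    by rewrite ifN //; apply: contra iX; apply/subsetP.
  by rewrite mulr0 [RHS](bigD1 x) //= (negPf xX) xA mul0r.
rewrite -prodr_const [RHS]big_mkcond; apply: eq_bigr => i _.
by case: (i \in A); rewrite ?addr0 ?subrKC.
Qed.

Lemma subset_mean_cst (c : R) : subset_mean (fun=> c) = c.
Proof.
transitivity (c * subset_mean (fun X => (set0 \subset X)%:R)).
  by rewrite -subset_meanZ; apply: eq_bigr => X _; rewrite sub0set mulr1.
by rewrite subset_mean_supset cards0 mulr1.
Qed.

Lemma subset_mean_bin A (k : nat) :
  subset_mean (fun X => 'C(#|A :&: X|, k)%:R) = 'C(#|A|, k)%:R * p ^+ k.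
Proof.
pose draws := [set B : {set T} | B \subset A & #|B| == k].
transitivity (\sum_(B in draws) subset_mean (fun X => (B \subset X)%:R)).
  rewrite -subset_mean_sum; apply: eq_bigr => X _; congr (_ * _).
  rewrite sum_indicator -cards_draws; congr (_%:R).
  by apply: eq_card => B; rewrite !inE subsetI andbAC.
rewrite -cards_draws mulr_natl -sumr_const; apply: eq_bigr => B.
by rewrite inE subset_mean_supset => /andP[_ /eqP->].
Qed.

Lemma subset_mean_card : subset_mean (fun X => #|X|%:R) = #|T|%:R * p.
Proof.
rewrite -(bin1 #|T|) -[p in RHS]expr1 -cardsT -subset_mean_bin.
by apply: eq_bigr => X _; rewrite setTI bin1.
Qed.

End RandomSubset.

Section RandomSubsetBounds.
Variables (R : numDomainType) (T : finType) (p : R).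
Hypothesis p01 : 0 <= p <= 1.

Lemma subset_weight_ge0 (X : {set T}) : 0 <= subset_weight p X.
Proof.
have /andP[p0 p1] := p01.
by apply: prodr_ge0 => i _; case: ifP; rewrite ?subr_ge0.
Qed.

Lemma ler_subset_mean (f g : {set T} -> R) :
  (forall X, f X <= g X) -> subset_mean p f <= subset_mean p g.
Proof.
by move=> fg; apply: ler_sum => X _; rewrite ler_wpM2l ?subset_weight_ge0.
Qed.

(* Markov's inequality for ['C(#|A :&: X|, k)]. *)
Lemma subset_mean_card_geq (A : {set T}) (k : nat) :
  subset_mean p (fun X => (k <= #|A :&: X|)%N%:R) <= 'C(#|A|, k)%:R * p ^+ k.
Proof.
rewrite -subset_mean_bin; apply: ler_subset_mean => X.
by rewrite -bin_gt0 ler_nat; case: 'C(_, _).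
Qed.

Lemma subset_mean_card_setD_leq (A : {set T}) (m k M : nat) :
  (m + k <= #|A|)%N -> (#|A| <= M)%N ->
  subset_mean p (fun X => (#|A :\: X| <= m)%N%:R) <= M%:R ^+ m * p ^+ k.
Proof.
move=> mkA AM; have mA : (m <= #|A|)%N by lia.
have /andP[p0 p1] := p01.
apply: (@le_trans _ _ ('C(#|A|, #|A| - m)%:R * p ^+ (#|A| - m))).
  apply: le_trans (subset_mean_card_geq A _); apply: ler_subset_mean => X.
  by rewrite ler_nat; have := cardsID X A; lia.
have bin_le : ('C(#|A|, #|A| - m) <= M ^ m)%N.
  rewrite bin_sub // (leq_trans (bin_leq_exp _ _)) //.
  by case: m {mkA mA} => // m; rewrite leq_exp2r.
apply: ler_pM; rewrite ?ler0n ?exprn_ge0 -?natrX ?ler_nat //.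
by apply: ler_wiXn2l => //; lia.
Qed.

End RandomSubsetBounds.

Local Close Scope ring_scope.

Section Codes.
Variables (n : nat) (G : sgraph n).
Implicit Types (u v w : 'I_n) (b : 'I_n * 'I_n) (C X : {set 'I_n}).

Lemma id_codeP (r : nat) C :
  reflect (forall u v, u != v -> r <= #|(cnbh G v :\: cnbh G u) :&: C|)
          (id_code G r C).
Proof. exact: 'forall_'forall_implyP. Qed.

Lemma strong_nbhW (k l : nat) : k <= l -> strong_nbh G l -> strong_nbh G k.
Proof. by move=> kl sG u v /sG; apply: leq_trans. Qed.

Lemma cnbh_sym u v : (u \in cnbh G v) = (v \in cnbh G u).
Proof. by rewrite !inE eq_sym adj_sym. Qed.

Lemma card_cnbh v : #|cnbh G v| = #|nbh G v|.+1.
Proof. by rewrite cardsU1 inE adj_irrefl. Qed.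

Lemma card_cnbh_leq v : #|cnbh G v| <= maxdeg G + 1.
Proof. by rewrite card_cnbh addn1 ltnS (leq_bigmax v). Qed.

Lemma maxdeg_leq_predn : maxdeg G <= n.-1.
Proof.
apply/bigmax_leqP => v _; have := max_card (cnbh G v).
by rewrite card_cnbh card_ord; lia.
Qed.

Lemma id_code_meets_cnbh (r : nat) C v :
  0 < r -> 1 < n -> id_code G r C -> cnbh G v :&: C != set0.
Proof.
move=> r0 n1 /id_codeP codeC.
have /card_gt0P[u] : 0 < #|[set~ v]| by rewrite cardsC1 card_ord; lia.
rewrite !inE => /codeC/(leq_trans r0) meet.
by rewrite -card_gt0 (leq_trans meet) ?subset_leq_card ?setSI ?subsetDl.
Qed.

Lemma leq_mul_card_id_code (r : nat) C :
  0 < r -> 1 < n -> id_code G r C -> n <= #|C| * (maxdeg G + 1).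
Proof.
move=> r0 n1 codeC.
have cover : [set: 'I_n] \subset \bigcup_(c in C) cnbh G c.
  apply/subsetP => v _.
  have /set0Pn[c /setIP[cv Cc]] := id_code_meets_cnbh v r0 n1 codeC.
  by apply/bigcupP; exists c; rewrite // cnbh_sym.
rewrite -[leqLHS]card_ord -cardsT (leq_trans (subset_leq_card cover)) //.
by apply: card_bigcup_leq_mul => c _; apply: card_cnbh_leq.
Qed.

Definition separators b : {set 'I_n} := cnbh G b.2 :\: cnbh G b.1.

Definition close_pairs : {set 'I_n * 'I_n} :=
  [set b | (b.1 != b.2) && (cnbh G b.1 :&: cnbh G b.2 != set0)].

Definition deficient_pairs (r : nat) X : {set 'I_n * 'I_n} :=
  [set b in close_pairs | #|separators b :\: X| < r].

Lemma card_separators_leq b : #|separators b| <= maxdeg G + 1.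
Proof. exact: leq_trans (subset_leq_card (subsetDl _ _)) (card_cnbh_leq _). Qed.

Lemma card_separators_geq (k : nat) b :
  strong_nbh G k -> b \in close_pairs -> k <= #|separators b|.
Proof. by move=> sG; rewrite inE => /andP[/sG]. Qed.

Lemma card_close_pairs_leq : #|close_pairs| <= n * (maxdeg G + 1) ^ 2.
Proof.
apply: (@leq_trans #|\bigcup_(w in 'I_n) setX (cnbh G w) (cnbh G w)|).
  apply/subset_leq_card/subsetP => -[u v]; rewrite inE => /andP[_ /=].
  case/set0Pn => w /setIP[wu wv].
  by apply/bigcupP; exists w => //; rewrite inE /= !(cnbh_sym _ w) wu wv.
rewrite -[X in _ <= X * _]card_ord card_bigcup_leq_mul // => w _.
by rewrite cardsX leq_mul ?card_cnbh_leq.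
Qed.

Lemma strong_nbh_neq0 u v : strong_nbh G 2 -> u != v -> nbh G v != set0.
Proof.
move=> sG /sG/leq_trans/(_ (subset_leq_card (subsetDl _ _))).
by rewrite card_cnbh ltnS card_gt0.
Qed.

Lemma adj_close_pairs u v : G u v -> (u, v) \in close_pairs.
Proof.
move=> uv; rewrite inE /=; apply/andP; split.
  by apply: contraTneq uv => ->; rewrite adj_irrefl.
by apply/set0Pn; exists v; rewrite !inE uv eqxx orbT.
Qed.

(* A pair with disjoint closed neighbourhoods is handled by replacing [u] with
   a neighbour of [v], which only shrinks [N[v] \ N[u]]. *)
Lemma id_code_close_pairs (r : nat) C : strong_nbh G 2 ->
  (forall b, b \in close_pairs -> r <= #|separators b :&: C|) ->
  id_code G r C.
Proof.
move=> sG closeC; apply/id_codeP => u v uv.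
have [disj|meet] := boolP (cnbh G u :&: cnbh G v == set0); last first.
  by apply: (closeC (u, v)); rewrite inE /= uv.
have /set0Pn[w] := strong_nbh_neq0 sG uv.
rewrite inE adj_sym => /adj_close_pairs wv.
apply: leq_trans (closeC _ wv) (subset_leq_card (setSI _ _)).
have /setDidPl-> : [disjoint cnbh G v & cnbh G u].
  by rewrite disjoint_sym -setI_eq0.
exact: subsetDl.
Qed.

Lemma exists_id_code_repair (r : nat) X : strong_nbh G 2 -> strong_nbh G r ->
  exists2 U : {set 'I_n}, #|U| <= #|deficient_pairs r X| * r
    & id_code G r (~: X :|: U).
Proof.
move=> sG2 sGr.
have large b : b \in deficient_pairs r X -> r <= #|separators b|.
  by rewrite inE => /andP[/(card_separators_geq sGr)].
have [U cardU hitU] := exists_hitting_set large.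
exists U => //; apply: id_code_close_pairs => // b close_b.
have [/hitU/leq_trans|] := boolP (b \in deficient_pairs r X).
  by apply; apply/subset_leq_card/setIS/subsetUr.
rewrite inE close_b -leqNgt setDE => /leq_trans; apply.
exact/subset_leq_card/setIS/subsetUl.
Qed.

Lemma min_id_code_alteration (r : nat) X : 0 < r -> strong_nbh G r.+1 ->
  min_id_code G r + #|X| <= n + #|deficient_pairs r X| * r.
Proof.
move=> r0 sG.
have sG2 : strong_nbh G 2 by apply: strong_nbhW sG.
have [U cardU codeU] := exists_id_code_repair X sG2 (strong_nbhW (leqnSn r) sG).
have [_ /(_ _ codeU) min_le] := min_id_codeP codeU.
have [card_le _] := leq_card_setU (~: X) U.
by have := cardsC X; rewrite card_ord; lia.
Qed.

End Codes.

Local Open Scope ring_scope.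

Section RandomCode.
Variables (R : numDomainType) (n : nat) (G : sgraph n) (r d : nat) (p : R).
Hypotheses (p01 : 0 <= p <= 1) (r_gt0 : (0 < r)%N).
Hypothesis G_strong : strong_nbh G (r + d + 1).
Let M : R := (maxdeg G + 1)%:R.

Lemma subset_mean_deficient_pairs :
  subset_mean p (fun X => #|deficient_pairs G r X|%:R)
    <= n%:R * M ^+ r.+1 * p ^+ d.+2.
Proof.
have /andP[p0 _] := p01.
have -> : subset_mean p (fun X => #|deficient_pairs G r X|%:R) =
    \sum_(b in close_pairs G)
      subset_mean p (fun X => (#|separators G b :\: X| < r)%N%:R).
  by rewrite -subset_mean_sum; apply: eq_bigr => X _; rewrite sum_indicator.
apply: (@le_trans _ _ (\sum_(b in close_pairs G) M ^+ r.-1 * p ^+ d.+2)).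
  apply: ler_sum => b /(card_separators_geq G_strong) sep_b.
  rewrite -{1}(prednK r_gt0).
  by apply: (subset_mean_card_setD_leq p01 _ (card_separators_leq G b)); lia.
rewrite sumr_const -[leLHS]mulr_natl mulrA ler_wpM2r ?exprn_ge0 //.
have -> : r.+1 = (2 + r.-1)%N by lia.
rewrite exprD mulrA ler_wpM2r ?exprn_ge0 ?ler0n //.
by rewrite -natrX -natrM ler_nat card_close_pairs_leq.
Qed.

Lemma min_id_code_leq_mean :
  (min_id_code G r)%:R <= n%:R * (1 - (p - r%:R * M ^+ r.+1 * p ^+ d.+2)).
Proof.
have sG : strong_nbh G r.+1 by apply: strong_nbhW G_strong; lia.
have : subset_mean p (fun X : {set 'I_n} => (min_id_code G r)%:R + #|X|%:R)
    <= subset_mean p (fun X => n%:R + r%:R * #|deficient_pairs G r X|%:R).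
  apply: (ler_subset_mean p01) => X.
  by rewrite mulrC -natrM -!natrD ler_nat min_id_code_alteration.
rewrite !subset_meanD subset_meanZ !subset_mean_cst subset_mean_card card_ord.
rewrite -lerBrDr => /le_trans; apply.
have -> : n%:R * (1 - (p - r%:R * M ^+ r.+1 * p ^+ d.+2)) =
    n%:R + r%:R * (n%:R * M ^+ r.+1 * p ^+ d.+2) - n%:R * p by ring.
by rewrite lerD2r lerD2l ler_wpM2l ?ler0n // subset_mean_deficient_pairs.
Qed.

(* The larger coefficient [2 r (Delta + 1)^(r+2)] and the smaller exponent
   [d + 1] are the ones for which [cst_dr] is the optimum. *)
Lemma min_id_code_leq_alteration :
  (min_id_code G r)%:R <=
    n%:R * (1 - (p - (2 * r)%:R * M ^+ (r + 2) * p ^+ d.+1)).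
Proof.
have /andP[p0 p1] := p01; have M1 : 1 <= M by rewrite ler1n addn1.
have M0 := le_trans ler01 M1.
have coef_le : r%:R * M ^+ r.+1 <= (2 * r)%:R * M ^+ (r + 2).
  apply: ler_pM; rewrite ?exprn_ge0 ?ler0n // ?ler_nat ?leq_pmull //.
  by rewrite ler_weXn2l // addn2.
apply: le_trans min_id_code_leq_mean _.
rewrite ler_wpM2l ?ler0n // lerD2l lerN2 lerD2l lerN2.
apply: ler_pM => //.
- by rewrite mulr_ge0 ?exprn_ge0 ?ler0n.
- exact: exprn_ge0.
- by apply: ler_wiXn2l.
Qed.

End RandomCode.

Lemma powR_opp_ge0_le1 (R : realType) (x y : R) :
  1 <= x -> 0 <= y -> 0 <= x `^ (- y) <= 1.
Proof.
by move=> x1 y0; rewrite powR_ge0 -(powRr0 x) ler_powR ?oppr_le0.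
Qed.

Lemma exprn_powR_opp_invn (R : realType) (d : nat) (x : R) :
  (0 < d)%N -> 0 <= x -> (x `^ (- d%:R^-1)) ^+ d = x^-1.
Proof.
move=> d0 x0; rewrite -powR_mulrn ?powR_ge0 // -powRrM mulNr mulVf.
  exact: powR_inv1.
by rewrite pnatr_eq0 -lt0n.
Qed.

Lemma alteration_optimum (R : realType) (d : nat) (A : R) :
  (0 < d)%N -> 0 < A ->
  let p := (A * d.+1%:R) `^ (- d%:R^-1) in
  p - A * p ^+ d.+1 = d%:R / d.+1%:R * p.
Proof.
move=> d0 A0 p; rewrite exprSr exprn_powR_opp_invn ?mulr_ge0 ?ler0n ?ltW //.
have d10 : d%:R + 1 != 0 :> R by rewrite natr1 pnatr_eq0.
by rewrite -natr1; field; rewrite d10 gt_eqF.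
Qed.

Lemma cst_drE (R : realType) (r d M : nat) :
  cst_dr R d r / M%:R `^ ((r + 2)%:R / d%:R) =
  d%:R / d.+1%:R *
    ((2 * r)%:R * M%:R ^+ (r + 2) * d.+1%:R) `^ (- d%:R^-1).
Proof.
rewrite /cst_dr powRD ?pnatr_eq0 ?implybT // powR_inv1 ?ler0n //.
rewrite -powRN -mulrN powRrM powR_mulrn ?ler0n //.
by rewrite !powRM ?mulr_ge0 ?exprn_ge0 ?ler0n //; ring.
Qed.

Theorem theorem1 (R : realType) (n r d : nat) (G : sgraph n)
  (r_ge1 : (1 <= r)%N) (d_ge1 : (1 <= d)%N)
  (G_strong : strong_nbh G (r + d + 1)%N)
  (Delta_ge2 : (2 <= maxdeg G)%N) :
  1 / (maxdeg G + 1)%:R <= (min_id_code G r)%:R / n%:R :> R /\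
  (min_id_code G r)%:R / n%:R <=
    1 - cst_dr R d r / (maxdeg G + 1)%:R `^ ((r + 2)%:R / d%:R) :> R.
Proof.
have n1 : (1 < n)%N by have := maxdeg_leq_predn G; lia.
have n0 : 0 < n%:R :> R by rewrite ltr0n ltnW.
split.
  have /min_id_codeP[[C codeC <-] _] : id_code G r setT.
    by apply: strong_nbh_id_codeT G_strong; lia.
  rewrite ler_pdivlMr // mulrAC ler_pdivrMr ?ltr0n ?addn1 // mul1r -natrM.
  by rewrite ler_nat -addn1 (leq_mul_card_id_code r_ge1).
set A : R := (2 * r)%:R * (maxdeg G + 1)%:R ^+ (r + 2).
have A1 : 1 <= A by rewrite mulr_ege1 ?exprn_ege1 ?ler1n ?muln_gt0 ?addn1.
have p01 : 0 <= (A * d.+1%:R) `^ (- d%:R^-1) <= 1.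
  by rewrite powR_opp_ge0_le1 ?invr_ge0 ?ler0n // mulr_ege1 ?ler1n.
rewrite cst_drE -alteration_optimum ?(lt_le_trans ltr01) //.
rewrite ler_pdivrMr // mulrC.
exact: min_id_code_leq_alteration.
Qed.
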